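(* The following conditions are true. (1) Over a semiperfect ring $R$, every max-projective right $R$-module $M$ with small radical (i.e. $\operatorname{Rad}(M)\ll M$) is projective. (2) A ring $R$ is right perfect if and only if $R$ is semilocal and every max-projective right $R$-module is projective.
   Context: Rings are associative with identity; modules are unital right modules. A right $R$-module $M$ is max-projective if for every maximal right ideal $I$ of $R$, every homomorphism $M\to R/I$ factors through the canonical projection $R\to R/I$. $K\ll M$ means that $K$ is a superfluous submodule of $M$: $K+L\neq M$ for every proper submodule $L$ of $M$. $\operatorname{Rad}(M)$ is the Jacobson radical of $M$ (the intersection of all maximal submodules, equal to $M$ if there are none). A ring $R$ is semilocal if $R/J(R)$ is semisimple, where $J(R)$ is the Jacobson radical. *)

(* Defs.v *)
From HB Require Import structures.
From mathcomp Require Import all_boot all_algebra.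
From mathcomp Require Import boolp.

Set Implicit Arguments.
Unset Strict Implicit.
Unset Printing Implicit Defensive.

Import GRing.Theory.
Local Open Scope ring_scope.
Local Open Scope quotient_scope.

(* A right R-module is a left module over the converse ring: x.r is           *)
(* (r : R^c) *: x.  In particular rreg R is R_R, and its submodules are the   *)
(* right ideals of R.  Rings are pzRingType, so the zero ring is allowed.     *)
Notation rmodType R := (lmodType R^c).
Notation rreg R := ((R^c)^o).

(* Submodules are boolean predicates; with the classical axioms these are the *)
(* same as arbitrary subsets closed under the module operations.              *)
Section Submodules.
Variables (S : pzRingType) (M : lmodType S).
Implicit Types K L N : submodClosed M.

Definition proper_submod N := exists x, x \notin N.

Definition maximal_submod N :=
  proper_submod N /\
  forall L, {subset N <= L} -> proper_submod L -> L =i N.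

(* K + L = M *)
Definition sum_is_full (K L : {pred M}) :=
  forall x, exists2 y, y \in K & exists2 z, z \in L & x = y + z.

Definition superfluous (K : {pred M}) :=
  forall L, proper_submod L -> ~ sum_is_full K L.

Definition direct_summand N :=
  exists L, sum_is_full N L /\ (forall x, x \in N -> x \in L -> x = 0).

Definition Rad : {pred M} :=
  fun x => `[< forall N, maximal_submod N -> x \in N >].

Lemma Rad_submod_closed : submod_closed Rad.
Proof.
split=> [|a x y /asboolP xR /asboolP yR]; apply/asboolP => N maxN.
  exact: (submodClosedP N).1.
by apply: (submodClosedP N).2; [exact: xR | exact: yR].
Qed.

HB.instance Definition _ := GRing.isSubmodClosed.Build S M Rad
  Rad_submod_closed.

End Submodules.
Arguments Rad {S} M.

Definition semisimple (S : pzRingType) (M : lmodType S) :=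
  forall N : submodClosed M, direct_summand N.

Section QuotientModule.
Variables (S : pzRingType) (M : lmodType S) (N : submodClosed M).

Definition zmod_of_submod : zmodClosed M :=
  HB.pack (GRing.SubmodClosed.sort N)
    (GRing.isZmodClosed.Build M (GRing.SubmodClosed.sort N)
      (GRing.submod_closedB (submodClosedP N))).

Definition qmod := Quotient.quot zmod_of_submod.
HB.instance Definition _ := GRing.Zmodule.on qmod.

Definition qproj (x : M) : qmod := \pi x.

Lemma qproj_eq x y : (qproj x = qproj y) <-> (x - y \in N).
Proof.
rewrite -[x - y \in N]/(x - y \in zmod_of_submod) Quotient.idealrBE.
exact: (rwP eqP).
Qed.

Lemma qproj_surj (u : qmod) : qproj (repr u) = u.
Proof. exact: reprK. Qed.

Fact qproj_is_zmod_morphism : zmod_morphism qproj.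
Proof. by move=> x y; rewrite /qproj raddfB. Qed.
HB.instance Definition _ :=
  GRing.isZmodMorphism.Build M qmod qproj qproj_is_zmod_morphism.

Definition qscale (a : S) (u : qmod) : qmod := qproj (a *: repr u).

Lemma qscaleE a x : qscale a (qproj x) = qproj (a *: x).
Proof.
apply/qproj_eq; rewrite -scalerBr rpredZ //.
by apply/qproj_eq; rewrite qproj_surj.
Qed.

Fact qscaleA a b u : qscale a (qscale b u) = qscale (a * b) u.
Proof. by rewrite -(qproj_surj u) !qscaleE scalerA. Qed.
Fact qscale1 : left_id 1 qscale.
Proof. by move=> u; rewrite -(qproj_surj u) qscaleE scale1r. Qed.
Fact qscaleDr : right_distributive qscale +%R.
Proof.
move=> a u v; rewrite -(qproj_surj u) -(qproj_surj v) -raddfD !qscaleE.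
by rewrite scalerDr raddfD.
Qed.
Fact qscaleDl u : {morph qscale^~ u : a b / a + b}.
Proof.
by move=> a b; rewrite -(qproj_surj u) !qscaleE scalerDl raddfD.
Qed.

HB.instance Definition _ := GRing.Zmodule_isLmodule.Build S qmod
  qscaleA qscale1 qscaleDr qscaleDl.

Fact qproj_is_scalable : scalable qproj.
Proof. by move=> a x; rewrite -qscaleE. Qed.
HB.instance Definition _ :=
  GRing.isScalable.Build S M qmod *:%R qproj qproj_is_scalable.

End QuotientModule.

Section Projectivity.
Variable S : pzRingType.

Definition surjective (A B : Type) (f : A -> B) := forall y, exists x, f x = y.

Definition kernel (A B : lmodType S) (f : {linear A -> B}) : {pred A} :=
  fun x => f x == 0.

Definition projective (P : lmodType S) :=
  forall (A B : lmodType S) (g : {linear A -> B}) (f : {linear P -> B}),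
    surjective g -> exists h : {linear P -> A}, forall x, g (h x) = f x.

Definition is_projective_cover (P M : lmodType S) (p : {linear P -> M}) :=
  [/\ projective P, surjective p & superfluous (kernel p)].

End Projectivity.

Definition max_projective (R : pzRingType) (M : rmodType R) :=
  forall I : submodClosed (rreg R), maximal_submod I ->
  forall f : {linear M -> qmod I},
  exists g : {linear M -> rreg R}, forall x, f x = qproj I (g x).

Section RadFunctorial.
Variables (S : pzRingType) (A B : lmodType S) (f : {linear A -> B}).

Lemma preim_submod_closed (N : submodClosed B) :
  submod_closed ([pred x | f x \in N] : {pred A}).
Proof.
split=> [|a x y]; rewrite !inE; first by rewrite raddf0 (submodClosedP N).1.
by move=> xN yN; rewrite linearP (submodClosedP N).2.
Qed.

Lemma add_im_submod_closed (N : submodClosed B) (L : submodClosed A) :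
  submod_closed ((fun y => `[< exists2 n, n \in N &
                             exists2 l, l \in L & y = n + f l >]) : {pred B}).
Proof.
split=> [|a x y /asboolP[n nN [l lL ->]] /asboolP[m mN [k kL ->]]];
  apply/asboolP.
  exists 0; first exact: (submodClosedP N).1.
  by exists 0; [exact: (submodClosedP L).1 | rewrite raddf0 addr0].
exists (a *: n + m); first exact: (submodClosedP N).2.
exists (a *: l + k); first exact: (submodClosedP L).2.
by rewrite linearP scalerDr addrACA.
Qed.

Lemma linear_Rad x : x \in Rad A -> f x \in Rad B.
Proof.
move=> /asboolP xR; apply/asboolP => N [prN maxN]; apply: contrapT => /negP xN.
pose N' : submodClosed A := HB.pack (fun x => f x \in N)
  (GRing.isSubmodClosed.Build _ _ (fun x => f x \in N)
    (preim_submod_closed N)).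
suff maxN' : maximal_submod N'.
  by move/negP: xN; apply; apply: (xR _ maxN').
split=> [|L N'L [z zL] y]; first by exists x.
apply/idP/idP => [yL|]; last exact: N'L.
apply: contrapT => /negP yN.
pose T' (b : B) := `[< exists2 n, n \in N & exists2 l, l \in L & b = n + f l >].
pose T : submodClosed B := HB.pack T'
  (GRing.isSubmodClosed.Build _ _ T' (add_im_submod_closed N L)).
have NT : {subset N <= T}.
  move=> n nN; apply/asboolP; exists n => //.
  by exists 0; [exact: (submodClosedP L).1 | rewrite raddf0 addr0].
have Tfy : f y \in T.
  by apply/asboolP; exists 0; [exact: (submodClosedP N).1 | exists y; rewrite ?add0r].
case: (pselect (proper_submod T)) => [/(maxN _ NT) TN | Tfull].
  by move/negP: yN; apply; rewrite -[_ \in _]/(f y \in N) -TN.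
have /asboolP[n nN [l lL fz]] : f z \in T.
  by apply: contrapT => /negP zT; apply: Tfull; exists (f z).
move/negP: zL; apply; rewrite -(subrK l z) rpredD //; apply: N'L.
by rewrite -[_ \in _]/(f (z - l) \in N) linearB fz addrK.
Qed.
End RadFunctorial.

Section QuotientRing.
Variables (R : pzRingType) (I : submodClosed (rreg R)).
Hypothesis leftI : forall a x : R, x \in I -> a * x \in I.

Definition qring of (forall a x : R, x \in I -> a * x \in I) := qmod I.
Local Notation Q := (qring leftI).
HB.instance Definition _ := GRing.Zmodule.on Q.

Definition qring_proj (x : R) : Q := qproj I x.

Definition qmul (u v : Q) : Q := qring_proj (@GRing.mul R (repr u) (repr v)).

Lemma qring_proj_surj (u : Q) : qring_proj (repr u) = u.
Proof. exact: qproj_surj. Qed.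

Lemma qmulE x y : qmul (qring_proj x) (qring_proj y) = qring_proj (x * y).
Proof.
have E (z : R) : repr (qring_proj z) - z \in I.
  by apply/qproj_eq; exact: qring_proj_surj.
apply/qproj_eq; move: (E x) (E y).
move: (repr _) (repr _) => y' x' Ex Ey.
have: ((x' : R) - x) * y' + x * ((y' : R) - y) \in I.
  have Ey' := leftI x Ey.
  have Ex' := @rpredZ R^c (rreg R) I y' _ Ex.
  exact: (@rpredD _ I _ _ Ex' Ey').
by rewrite mulrBl mulrBr addrA subrK.
Qed.

Fact qmulA : associative qmul.
Proof.
move=> u v w; rewrite -(qring_proj_surj u) -(qring_proj_surj v).
by rewrite -(qring_proj_surj w) !qmulE mulrA.
Qed.
Fact qmul1l : left_id (qring_proj 1) qmul.
Proof. by move=> u; rewrite -(qring_proj_surj u) qmulE mul1r. Qed.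
Fact qmul1r : right_id (qring_proj 1) qmul.
Proof. by move=> u; rewrite -(qring_proj_surj u) qmulE mulr1. Qed.

Fact qring_projD (x y : R) : qring_proj (x + y) = qring_proj x + qring_proj y.
Proof. exact: (raddfD (qproj I)). Qed.

Fact qmulDl : left_distributive qmul +%R.
Proof.
move=> u v w; rewrite -(qring_proj_surj u) -(qring_proj_surj v).
by rewrite -(qring_proj_surj w) -qring_projD !qmulE -qring_projD mulrDl.
Qed.
Fact qmulDr : right_distributive qmul +%R.
Proof.
move=> u v w; rewrite -(qring_proj_surj u) -(qring_proj_surj v).
by rewrite -(qring_proj_surj w) -qring_projD !qmulE -qring_projD mulrDr.
Qed.

HB.instance Definition _ := GRing.Zmodule_isPzRing.Build Q
  qmulA qmul1l qmul1r qmulDl qmulDr.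

Fact qring_proj_is_zmod_morphism : zmod_morphism qring_proj.
Proof. exact: (raddfB (qproj I)). Qed.
HB.instance Definition _ :=
  GRing.isZmodMorphism.Build R Q qring_proj qring_proj_is_zmod_morphism.
Fact qring_proj_is_monoid_morphism : monoid_morphism qring_proj.
Proof. by split=> // x y; rewrite -qmulE. Qed.
HB.instance Definition _ :=
  GRing.isMonoidMorphism.Build R Q qring_proj qring_proj_is_monoid_morphism.
End QuotientRing.

Section RingConditions.
Variable R : pzRingType.

(* J(R) is Rad (rreg R), the intersection of the maximal right ideals; being  *)
(* also a left ideal, it has a quotient ring.                                 *)
Lemma Jacobson_left (a x : R) : x \in Rad (rreg R) -> a * x \in Rad (rreg R).
Proof.
pose f (y : rreg R) : rreg R := a * (y : R).
have f_lin : linear f by move=> c y z; rewrite /f mulrDr mulrA.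
pose F : {linear rreg R -> rreg R} :=
  HB.pack f (GRing.isLinear.Build R^c (rreg R) (rreg R) *:%R f f_lin).
exact: (@linear_Rad _ _ _ F x).
Qed.

Definition quotJ := qring Jacobson_left.
HB.instance Definition _ := GRing.PzRing.on quotJ.

Definition projJ : R -> quotJ := qring_proj Jacobson_left.
HB.instance Definition _ :=
  GRing.RMorphism.copy projJ (qring_proj Jacobson_left).

(* A ring is semisimple when it is so as a right module over itself.          *)
Definition semilocal := semisimple (rreg quotJ).

Definition idempotents_lift_mod_J :=
  forall u : quotJ, u * u = u -> exists2 e : R, e * e = e & projJ e = u.

Definition semiperfect := semilocal /\ idempotents_lift_mod_J.

Definition right_perfect :=
  forall M : rmodType R,
  exists (P : rmodType R) (p : {linear P -> M}), is_projective_cover p.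

End RingConditions.

(* Main.v *)
Require Import Defs.
From HB Require Import structures.
From mathcomp Require Import all_boot all_algebra.
From mathcomp Require Import boolp classical_sets functions.

(** Let [J] be the Jacobson radical of [R]. Everything rests on one property,
    shared by semiperfect and right perfect rings: a right ideal [I] above [J]
    is cut by an idempotent [e], in the sense that [r] is in [I] exactly when
    [e r] is in [J] ([semiperfect_cut], [perfect_cut]). If [I] is maximal, then
    [e R] is a local projective module with simple top [R / I].

    Suppose that [Rad M] is superfluous. By Zorn's lemma there is a maximal
    family of maps [e R -> M], with [e] running over such local idempotents,
    that is independent modulo [Rad M]. By maximality the images generate [M]
    modulo [Rad M], hence generate [M], and independence puts the kernel of the
    map [p] from the sum of the [e_i R] to [M] inside the elements with all
    coordinates in [J] ([local_cover_exists]). If moreover [M] is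
    max-projective, the coordinates, which are well defined on [M] modulo [J],
    lift to maps [M -> R]. Composed with [p] they give the identity of the
    direct sum modulo [J]. An element of the kernel involves finitely many
    coordinates only, so Nakayama's lemma shows that it vanishes
    ([local_cover_injective]). Thus [M] is isomorphic to the direct sum and
    projective, although [p] is not known beforehand to have a superfluous
    kernel.

    Over a right perfect ring all radicals are superfluous. Indeed a module [X]
    with [Rad X = X] has a projective cover without maximal submodules, and by
    a theorem of Bass a nonzero projective module has maximal submodules
    ([projective_Rad_eq0]); so [X = 0], and this applies to the quotients of
    [M] by the submodules [N] with [Rad M + N = M]. Hence max-projective
    modules are projective by the above; and [R] is semilocal since right
    ideals above [J] are cut by idempotents.

    Conversely, suppose that [R] is semilocal and that max-projective modules
    are projective. A module [X] with [Rad X = X] has no nonzero map to a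
    simple module, so it is max-projective, hence projective, hence zero by
    Bass. Again all radicals are superfluous. Applied to the free module of
    countable rank, this shows that the elements of [J] are nilpotent
    ([Jacobson_nil]), so idempotents lift modulo [J] and [R] is semiperfect.
    Now the map [p] above exists for every [M], and its kernel is superfluous
    because it is contained in a radical: it is a projective cover. *)

Set Implicit Arguments.
Unset Strict Implicit.
Unset Printing Implicit Defensive.

Import GRing.Theory.
Local Open Scope ring_scope.

(** The right action, x.r in the usual notation. *)
Reserved Notation "x ◃ r" (at level 40, left associativity).

(** * Maximal and superfluous submodules *)

Section Submodules.
Variable S : pzRingType.

Definition linear_of (A B : lmodType S) (f : A -> B) (f_lin : linear f) :
  {linear A -> B} := HB.pack f (GRing.isLinear.Build S A B *:%R f f_lin).

Definition submod_of (M : lmodType S) (N : {pred M}) (cN : submod_closed N) :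
  submodClosed M := HB.pack N (GRing.isSubmodClosed.Build S M N cN).

Lemma submodB (M : lmodType S) (N : submodClosed M) x y :
  x \in N -> y \in N -> x - y \in N.
Proof. exact: (GRing.submod_closedB (submodClosedP N)).2. Qed.

(** The unit of [S] makes properness of an ideal a condition on the single
    element 1, which passes to unions of chains; so Zorn's lemma applies. *)
Lemma maximal_submod_above (N : submodClosed S^o) : 1 \notin N ->
  exists2 I : submodClosed S^o, maximal_submod I & {subset N <= I}.
Proof.
move=> N1.
pose T := {L : submodClosed S^o | {subset N <= L} /\ 1 \notin L}.
pose le (L K : T) := `[< {subset sval L <= sval K} >].
have N0 : {subset N <= N} /\ 1 \notin N by split.
have le_refl t : le t t by apply/asboolP.
have le_trans r s t : le r s -> le s t -> le r t.
  by move=> /asboolP rs /asboolP st; apply/asboolP => x /rs /st.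
have [||A totA|[I [NI I1]] maxI] := @ZL_preorder T (exist _ N N0) le => //.
  pose U (x : S^o) := `[< x \in N \/ exists2 L : T, A L & x \in sval L >].
  have cU : submod_closed U.
    split=> [|a x y /asboolP xU /asboolP yU]; apply/asboolP.
      by left; exact: rpred0.
    case: xU yU => [xN|[L AL xL]] [yN|[K AK yK]].
    - by left; exact: (submodClosedP N).2.
    - right; exists K => //; apply: (submodClosedP (sval K)).2 => //.
      exact: (svalP K).1.
    - right; exists L => //; apply: (submodClosedP (sval L)).2 => //.
      exact: (svalP L).1.
    - case: (totA _ _ AL AK) => /asboolP LK; right.
        exists K => //; apply: (submodClosedP (sval K)).2 => //; exact: LK.
      exists L => //; apply: (submodClosedP (sval L)).2 => //; exact: LK.
  have NU : {subset N <= submod_of cU} by move=> x xN; apply/asboolP; left.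
  have U1 : 1 \notin submod_of cU.
    apply/negP => /asboolP[|[L _]]; first by move/negP: N1.
    by move/negP: (svalP L).2.
  exists (exist _ (submod_of cU) (conj NU U1)) => L AL.
  by apply/asboolP => x xL; apply/asboolP; right; exists L.
exists I => //; split; first by exists 1.
move=> L IL [x xL] y; apply/idP/idP; last exact: IL.
have L1 : 1 \notin L.
  by apply: contra xL => L1; rewrite -[x]mulr1; exact: (@rpredZ S S^o L x 1 L1).
have NL : {subset N <= L} by move=> z /NI /IL.
have/asboolP LI := maxI (exist _ L (conj NL L1)) (asboolT IL).
exact: LI.
Qed.

(** If a maximal [N] missed a point of [K], then [K + N] would be the whole
    module by maximality, although [K] is superfluous. *)
Lemma superfluous_Rad (M : lmodType S) (K : submodClosed M) :
  superfluous K -> {subset K <= Rad M}.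
Proof.
move=> supK x xK; apply/asboolP => N [prN maxN]; apply: contrapT => /negP xN.
apply: (supK N prN) => y.
pose L := submod_of (add_im_submod_closed idfun K N).
have NL : {subset N <= L}.
  move=> n nN; apply/asboolP; exists 0; first exact: rpred0.
  by exists n => //; rewrite add0r.
have xL : x \in L.
  apply/asboolP; exists x => //.
  by exists 0; [exact: rpred0 | rewrite addr0].
have [prL|fullL] := pselect (proper_submod L).
  by move/negP: xN; case; rewrite -(maxN _ NL prL).
have /asboolP // : y \in L.
by apply: contrapT => /negP yL; apply: fullL; exists y.
Qed.

(** Nakayama's lemma in the form used here: a map that is onto modulo a
    superfluous submodule is onto. *)
Lemma surjective_mod_superfluous (A B : lmodType S) (f : {linear A -> B})
    (K : {pred B}) :
  superfluous K -> (forall y, exists x, y - f x \in K) -> surjective f.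
Proof.
move=> supK fK y; apply: contrapT => yf.
pose T (z : B) := `[< exists x, z = f x >].
have cT : submod_closed T.
  split=> [|a _ _ /asboolP[u ->] /asboolP[v ->]]; apply/asboolP.
    by exists 0; rewrite raddf0.
  by exists (a *: u + v); rewrite linearP.
apply: (supK (submod_of cT)) => [|z].
  by exists y; apply/negP => /asboolP[x yx]; apply: yf; exists x.
have [x zx] := fK z; exists (z - f x) => //.
by exists (f x); [apply/asboolP; exists x | rewrite subrK].
Qed.

(** A maximal submodule [N] of [P] contains the kernel of [p], hence is the
    preimage of its image, which would be a maximal submodule of [X]. So [P]
    has no maximal submodule as soon as [X] has none. *)
Lemma Rad_full_of_kernel_Rad (P X : lmodType S) (p : {linear P -> X}) :
  surjective p -> (forall x, p x = 0 -> x \in Rad P) ->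
  (forall x : X, x \in Rad X) -> forall x, x \in Rad P.
Proof.
move=> p_surj kerR RadX x; apply/asboolP => N maxN; apply: contrapT => _.
have [[z zN] maxN'] := maxN.
pose T (u : X) := `[< exists2 n, n \in N & u = p n >].
have cT : submod_closed T.
  split=> [|a u v /asboolP[n nN ->] /asboolP[m mN ->]]; apply/asboolP.
    by exists 0; [exact: rpred0 | rewrite raddf0].
  by exists (a *: n + m); [exact: (submodClosedP N).2 | rewrite linearP].
have pT y : p y \in submod_of cT -> y \in N.
  move=> /asboolP[n nN pyn]; rewrite -(subrK n y) rpredD //.
  have /asboolP/(_ _ maxN) // : y - n \in Rad P.
  by apply: kerR; rewrite linearB pyn subrr.
suff maxT : maximal_submod (submod_of cT).
  have /asboolP/(_ _ maxT) := RadX (p z).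
  by move=> /pT; apply/negP.
split=> [|L TL [u uL] v]; first by exists (p z); apply: contra zN; exact: pT.
apply/idP/idP; last exact: TL.
pose L' := submod_of (preim_submod_closed p L).
have NL' : {subset N <= L'}.
  by move=> n nN; apply: TL; apply/asboolP; exists n.
have prL' : proper_submod L'.
  by have [y yu] := p_surj u; exists y; rewrite -[y \in _]/(p y \in L) yu.
have [y <-] := p_surj v => yL.
by apply/asboolP; exists y => //; rewrite -(maxN' _ NL' prL').
Qed.

Lemma qproj_eq0 (M : lmodType S) (I : submodClosed M) x :
  (qproj I x = 0) <-> (x \in I).
Proof. by rewrite -(raddf0 (qproj I)) qproj_eq subr0. Qed.

Lemma Rad_simple_quotient (M : lmodType S) (I : submodClosed M) (u : qmod I) :
  maximal_submod I -> u \in Rad (qmod I) -> u = 0.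
Proof.
move=> [[z zI] maxI] /asboolP uR.
have c0 : submod_closed (pred1 (0 : qmod I)).
  by split=> [|a x y /eqP-> /eqP->]; rewrite inE ?scaler0 ?addr0.
suff /uR/eqP : maximal_submod (submod_of c0) by [].
have q0 x : (qproj I x == 0) = (x \in I).
  by apply/eqP/idP => /qproj_eq0.
split=> [|L _ [v vL] w].
  by exists (qproj I z); rewrite -[_ \in _]/(_ == _) q0.
apply/idP/eqP => [|->]; last exact: rpred0.
pose L' := submod_of (preim_submod_closed (qproj I) L).
have IL' : {subset I <= L'}.
  move=> x xI; rewrite -[x \in _]/(qproj I x \in L).
  have/eqP-> : qproj I x == 0 by rewrite q0.
  exact: rpred0.
have prL' : proper_submod L'.
  by exists (repr v); rewrite -[_ \in _]/(qproj I (repr v) \in L) qproj_surj.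
rewrite -(qproj_surj w) => wL; apply/eqP; rewrite q0 -(maxI _ IL' prL').
exact: wL.
Qed.

(** If [Rad M + N = M], then [M / N] is its own radical. *)
Lemma Rad_superfluous (M : lmodType S) :
  (forall X : lmodType S, (forall x : X, x \in Rad X) -> forall x : X, x = 0) ->
  superfluous (Rad M).
Proof.
move=> Rad_eq0 N [x xN] full; move/negP: xN; apply.
have q0 : qproj N x = 0.
  apply: Rad_eq0 => u; rewrite -(qproj_surj u).
  have [y yR [z zN ->]] := full (repr u).
  have -> : qproj N (y + z) = qproj N y.
    by apply/qproj_eq; rewrite addrAC subrr add0r.
  exact: linear_Rad.
exact/qproj_eq0.
Qed.

Lemma kernel_closed (A B : lmodType S) (f : {linear A -> B}) :
  submod_closed (kernel f).
Proof.
split=> [|a x y]; rewrite !unfold_in ?raddf0 // => /eqP fx /eqP fy.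
by rewrite linearP fx fy scaler0 addr0.
Qed.

Lemma cover_kernel_Rad (P M : lmodType S) (p : {linear P -> M}) :
  is_projective_cover p -> forall x, p x = 0 -> x \in Rad P.
Proof.
case=> _ _ supK x px0.
apply: (@superfluous_Rad _ (submod_of (kernel_closed p)) supK).
by rewrite -[_ \in _]/(p x == 0) px0.
Qed.

Lemma superfluousS (M : lmodType S) (K L : {pred M}) :
  {subset K <= L} -> superfluous L -> superfluous K.
Proof.
move=> KL supL N prN full; apply: (supL N prN) => x.
by have [y /KL yL z] := full x; exists y.
Qed.

Lemma projective_iso (D M : lmodType S) (p : {linear D -> M}) :
  projective D -> surjective p -> (forall x, p x = 0 -> x = 0) -> projective M.
Proof.
move=> projD p_surj p_inj A B g f g_surj.
pose pre x := sval (cid (p_surj x)).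
have preK x : p (pre x) = x by rewrite /pre; case: cid.
have pre_lin : linear pre.
  move=> a x y; apply/eqP; rewrite -subr_eq0; apply/eqP/p_inj.
  by rewrite linearB linearP !preK subrr.
have [h hE] := projD _ _ g (f \o p) g_surj.
by exists (h \o linear_of pre_lin) => x; rewrite /= hE /= preK.
Qed.

End Submodules.

(** * The Jacobson radical *)

Section Jacobson.
Variable R : pzRingType.
Local Notation J := (Rad (rreg R)).
Local Notation "x ◃ r" := ((r : R^c) *: x).

Lemma ractA (M : rmodType R) (x : M) (a b : R) : x ◃ a ◃ b = x ◃ (a * b).
Proof. exact: scalerA. Qed.

Lemma ract_linear (M : rmodType R) (x : M) :
  linear ((fun r => x ◃ r) : rreg R -> M).
Proof. by move=> a r s; rewrite scalerDl scalerA. Qed.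

Lemma ract_Rad (M : rmodType R) (x : M) (r : R) : r \in J -> x ◃ r \in Rad M.
Proof. exact: (@linear_Rad _ _ _ (linear_of (ract_linear x))). Qed.

Lemma Jacobson_right (x a : R) : x \in J -> x * a \in J.
Proof. exact: (@rpredZ _ (rreg R)). Qed.

(** A maximal right ideal contains [x], so it does not contain [1 - x]; hence
    [1 - x] has a right inverse [y]. As [y = 1 + x y] is again of the form
    [1 - z] with [z] in [J], it is right invertible too, and so it is a
    two-sided inverse. *)
Lemma Jacobson_quasi_regular (x : R) : x \in J -> exists y : R, y * (1 - x) = 1.
Proof.
have rinv (z : R) : z \in J -> exists y : R, (1 - z) * y = 1.
  move=> zJ; apply: contrapT => noinv.
  pose T (y : rreg R) := `[< exists r : R, y = (1 - z) * r >].
  have cT : submod_closed T.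
    split=> [|a _ _ /asboolP[r ->] /asboolP[s ->]]; apply/asboolP.
      by exists 0; rewrite mulr0.
    by exists ((r : R) * (a : R) + s); rewrite mulrDr mulrA.
  have T1 : (1 : rreg R) \notin submod_of cT.
    by apply/negP => /asboolP[r r1]; apply: noinv; exists r.
  have [I maxI TI] := maximal_submod_above T1.
  have [[u /negP uI] _] := maxI; apply: uI.
  have zI : (z : rreg R) \in I by move/asboolP: zJ; apply.
  have I1 : (1 : rreg R) \in I.
    rewrite -(subrK (z : rreg R) 1) rpredD //; apply: TI; apply/asboolP.
    by exists 1; rewrite mulr1.
  by rewrite -[u]mulr1; exact: (@rpredZ _ (rreg R) I u 1 I1).
move=> xJ; have [y xy1] := rinv x xJ.
have yE : y = 1 - (- (x * y)) by rewrite opprK -[in RHS]xy1 mulrBl mul1r subrK.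
have [|z yz1] := rinv (- (x * y)).
  by rewrite -mulrN; exact: Jacobson_right.
rewrite -yE in yz1; exists y.
by have := congr1 ( *%R^~ z) xy1; rewrite -mulrA yz1 mulr1 mul1r => ->.
Qed.

Lemma idempotent_Jacobson (e : R) : e * e = e -> e \in J -> e = 0.
Proof.
move=> ee /Jacobson_quasi_regular[y y1].
by rewrite -[e]mul1r -y1 -mulrA mulrBl mul1r ee subrr mulr0.
Qed.

(** A homogeneous linear system with coefficient matrix [1 - c], [c] over [J],
    has only the zero solution: the diagonal entries of [1 - c] are left
    invertible, and eliminating one unknown leaves a smaller system of the same
    kind. This is Nakayama's lemma for the left ideal generated by the [r i],
    in coordinates; it is used both for radical projective modules and for the
    injectivity of local covers. *)
Lemma Nakayama_system (I : eqType) (s : seq I) (c : I -> I -> R) (r : I -> R) :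
  (forall i j, c i j \in J) ->
  (forall i, i \in s -> r i = \sum_(j <- s) c i j * r j) ->
  forall i, i \in s -> r i = 0.
Proof.
elim: s c => // k s IHs c cJ rE.
have [y y1] := Jacobson_quasi_regular (cJ k k).
have rk : r k = \sum_(j <- s) y * c k j * r j.
  rewrite -[LHS]mul1r -y1 -mulrA mulrBl mul1r {1}rE ?mem_head // big_cons.
  by rewrite addrC addKr big_distrr; apply: eq_bigr => j _; rewrite /= mulrA.
have rs0 i : i \in s -> r i = 0.
  apply: (IHs (fun i j => c i k * (y * c k j) + c i j)) => {}i => [j|is_].
    by apply: (@rpredD (rreg R) J) => //; apply: Jacobson_right.
  rewrite rE ?in_cons ?is_ ?orbT // big_cons {1}rk big_distrr -big_split /=.
  by apply: eq_bigr => j _; rewrite mulrDl mulrA.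
move=> i; rewrite in_cons => /orP[/eqP->|/rs0//].
by rewrite rk big_seq big1 // => j /rs0->; rewrite mulr0.
Qed.
End Jacobson.

(** * Direct sums of right ideals generated by idempotents *)

Section DirectSum.
Variables (R : pzRingType) (I : choiceType) (e : I -> R).
Local Notation J := (Rad (rreg R)).
Local Notation "x ◃ r" := ((r : R^c) *: x).

(** The direct sum of the right ideals [e i R], in coordinates: an element of
    [e R], [e] idempotent, is an [r] with [e r = r]. Taking all [e i] equal to
    1 gives the free module on [I]; [e i = 0] removes the index [i], which
    spares the passage to subsets of [I]. *)
Definition dsum_pred : {pred (I -> rreg R)} := fun f =>
  `[< (exists s : seq I, forall i, f i != 0 -> i \in s) /\
      (forall i, e i * (f i : R) = f i) >].

Fact dsum_pred_closed : submod_closed dsum_pred.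
Proof.
split=> [|a f g /asboolP[[s fs] ef] /asboolP[[t gt] eg]]; apply/asboolP; split.
- by exists [::] => i; rewrite eqxx.
- by move=> i; rewrite mulr0.
- exists (s ++ t) => i; rewrite mem_cat; apply: contraR.
  rewrite negb_or => /andP[si ti].
  have /eqP fi : f i == 0 by apply: contraNT si => /fs.
  have /eqP gi : g i == 0 by apply: contraNT ti => /gt.
  by rewrite -[(_ + _) i]/(a *: f i + g i) fi gi scaler0 addr0.
- move=> i; rewrite -[(_ + _) i]/((f i : R) * (a : R) + (g i : R)).
  by rewrite mulrDr mulrA ef eg.
Qed.
HB.instance Definition _ :=
  GRing.isSubmodClosed.Build _ (I -> rreg R) dsum_pred dsum_pred_closed.

Definition dsum := {f : I -> rreg R | dsum_pred f}.
HB.instance Definition _ := SubType.on dsum.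
HB.instance Definition _ := Choice.on dsum.
HB.instance Definition _ :=
  GRing.SubChoice_isSubLmodule.Build _ _ _ dsum dsum_pred_closed.

Definition coef (x : dsum) (i : I) : rreg R := val x i.

Lemma dsum_coefD r (x y : dsum) i :
  coef (r *: x + y) i = r *: coef x i + coef y i.
Proof. by []. Qed.

Lemma dsum_idem (x : dsum) i : e i * (coef x i : R) = coef x i.
Proof. by have /asboolP[] := valP x. Qed.

(** Some finite set of indices outside which [x] vanishes; it may contain
    indices where [x] is zero. *)
Definition supp (x : dsum) : seq I :=
  undup (sval (cid (proj1 (asboolW (valP x))))).

Lemma supp_uniq x : uniq (supp x).
Proof. exact: undup_uniq. Qed.

Lemma mem_supp x i : i \notin supp x -> coef x i = 0.
Proof.
rewrite mem_undup => xi; apply/eqP; apply: contraNT xi.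
by case: (cid _) i => s /= + i; exact.
Qed.

Lemma dsum_proj_linear i : linear ((fun x => coef x i) : dsum -> rreg R).
Proof. by []. Qed.
Definition dsum_proj i := linear_of (dsum_proj_linear i).

Section Lift.
Variables (M : rmodType R) (a : I -> M).

Definition dsum_sum (x : dsum) : M := \sum_(i <- supp x) a i ◃ coef x i.

(** The sum does not depend on the choice made in [supp]; any two elements can
    therefore be summed over a common list of indices. *)
Lemma dsum_sumE (s : seq I) (x : dsum) : uniq s ->
  (forall i, i \notin s -> coef x i = 0) ->
  dsum_sum x = \sum_(i <- s) a i ◃ coef x i.
Proof.
move=> us xs; rewrite /dsum_sum.
have drop (t : seq I) : \sum_(i <- t) a i ◃ coef x i =
    \sum_(i <- t | coef x i != 0) a i ◃ coef x i.
  rewrite [RHS]big_mkcond; apply: eq_bigr => i _.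
  by case: eqP => // ->; rewrite scale0r.
rewrite drop [RHS]drop -big_filter -[RHS]big_filter; apply: perm_big.
rewrite uniq_perm ?filter_uniq ?supp_uniq // => i.
rewrite !mem_filter; case: eqVneq => //= xi.
have -> : i \in s by apply: contraR xi => /xs->.
by apply: contraR xi => /mem_supp->.
Qed.

Lemma dsum_sum_linear : linear dsum_sum.
Proof.
move=> r x y; pose s := undup (supp x ++ supp y).
have us : uniq s by exact: undup_uniq.
have xs i : i \notin s -> coef x i = 0.
  by rewrite mem_undup mem_cat negb_or => /andP[/mem_supp].
have ys i : i \notin s -> coef y i = 0.
  by rewrite mem_undup mem_cat negb_or => /andP[_ /mem_supp].
rewrite (dsum_sumE us xs) (dsum_sumE us ys) (@dsum_sumE s) // => [|i si].
  rewrite scaler_sumr -big_split /=; apply: eq_bigr => i _.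
  by rewrite dsum_coefD scalerDl scalerA.
by rewrite dsum_coefD xs // ys // scaler0 addr0.
Qed.
Definition dsum_lift := linear_of dsum_sum_linear.
End Lift.

Hypothesis ee : forall i, e i * e i = e i.

Definition single_fun i : I -> rreg R := fun j => if j == i then e i else 0.

Lemma single_fun_closed i : dsum_pred (single_fun i).
Proof.
apply/asboolP; rewrite /single_fun; split=> [|j].
  by exists [:: i] => j; rewrite inE; case: (j == i); rewrite ?eqxx.
by case: eqP => [->|]; rewrite ?mulr0.
Qed.
Definition single i : dsum := exist _ (single_fun i) (single_fun_closed i).

(** The elements [single i] play the role of a basis; they need not be free, as
    [single i ◃ r] only depends on [e i * r]. *)
Lemma dsumE (x : dsum) : x = dsum_sum single x.
Proof.
apply/val_inj/funext => j.
rewrite -[LHS]/(coef x j) -[RHS]/(dsum_proj j (dsum_sum single x)).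
rewrite linear_sum /=.
have E i : dsum_proj j (single i ◃ coef x i) = if j == i then coef x i else 0.
  rewrite linearZ -[LHS]/((single_fun i j : R) * (coef x i : R)) /single_fun.
  by case: eqP => _; rewrite ?dsum_idem ?mul0r.
rewrite (eq_bigr _ (fun i _ => E i)).
have [js|js] := boolP (j \in supp x).
  rewrite (bigD1_seq j) ?supp_uniq //= eqxx big1 ?addr0 // => i /negPf.
  by rewrite eq_sym => ->.
rewrite big_seq big1 ?mem_supp // => i is_; case: eqP => // ji.
by rewrite -ji (negPf js) in is_.
Qed.

Lemma dsum_projective : projective dsum.
Proof.
move=> A B g f g_surj.
pose a i := sval (cid (g_surj (f (single i)))).
exists (dsum_lift a) => x; rewrite [in RHS](dsumE x) !linear_sum.
apply: eq_bigr => i _; rewrite !linearZ; congr (_ *: _).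
by rewrite /a; case: cid.
Qed.

Lemma dsum_Rad (x : dsum) : (forall i, coef x i \in J) -> x \in Rad dsum.
Proof.
move=> xJ; rewrite (dsumE x); apply: rpred_sum => i _.
exact: ract_Rad.
Qed.

End DirectSum.
Arguments dsum_lift {R I e M} a.

(** * Radicals of projective modules, and ideals above the radical *)

Section Perfect.
Variable R : pzRingType.
Local Notation J := (Rad (rreg R)).
Local Notation "x ◃ r" := ((r : R^c) *: x).

(** A nonzero projective module has a maximal submodule (Bass). Split [P] off
    the free module on its own elements, by [h]. If [P] is its own radical, the
    coordinates of every [h y] lie in [J], and the expression of [x] through
    its coordinates [r y] turns into a linear system over [J] satisfied by
    them. *)
Lemma projective_Rad_eq0 (P : rmodType R) :
  projective P -> (forall x : P, x \in Rad P) -> forall x : P, x = 0.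
Proof.
move=> projP RadP x.
have ee (y : P) : 1 * 1 = 1 :> R by rewrite mulr1.
pose F : rmodType R := dsum (fun _ : P => 1 : R).
pose q : {linear F -> P} := dsum_lift (fun y => y).
have q_surj : surjective q.
  move=> y; exists (single ee y).
  rewrite /= (@dsum_sumE _ _ _ _ _ [:: y]) //.
    by rewrite big_seq1 /= /coef /= /single_fun eqxx scale1r.
  by move=> z; rewrite inE /coef /= /single_fun => /negPf ->.
have [h hK] := projP _ _ q idfun q_surj.
pose c (z y : P) : R := coef (h y) z.
have cJ z y : c z y \in J.
  apply: (linear_Rad (dsum_proj _ z)); exact: (linear_Rad h).
pose r y : R := coef (h x) y.
have xE : x = \sum_(y <- supp (h x)) y ◃ r y by rewrite -[LHS]hK.
have r0 : forall y, y \in supp (h x) -> r y = 0.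
  apply: (Nakayama_system cJ) => z _.
  transitivity (dsum_proj _ z (h (\sum_(y <- supp (h x)) y ◃ r y))).
    by rewrite -xE.
  by rewrite !linear_sum; apply: eq_bigr => y _; rewrite !linearZ.
by rewrite xE big_seq big1 // => y /r0->; rewrite scale0r.
Qed.

(** A projective cover of [X] has no maximal submodule if [X] has none. *)
Lemma perfect_Rad_eq0 : right_perfect R ->
  forall X : rmodType R, (forall x : X, x \in Rad X) -> forall x : X, x = 0.
Proof.
move=> perfR X RadX x; have [P [p pcov]] := perfR X.
have [projP p_surj _] := pcov; have [y <-] := p_surj x.
have -> : y = 0; last exact: raddf0.
apply: (projective_Rad_eq0 projP).
exact: Rad_full_of_kernel_Rad p_surj (cover_kernel_Rad pcov) RadX.
Qed.

(** The form in which semiperfectness is used. It says that every [I] above [J]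
    is [(1 - e) R + J] for an idempotent [e]; written as an equation for
    membership, it gives at once that [e r] represents [r] modulo [I]. *)
Definition ideals_cut_by_idempotents :=
  forall I : submodClosed (rreg R), {subset J <= I} ->
  exists2 e : R, e * e = e & forall r : R, (r \in I) = (e * r \in J).

Lemma projJ_eq0 (r : R) : (projJ r = 0) <-> (r \in J).
Proof. exact: (@qproj_eq0 (rreg R)). Qed.

Lemma projJD (a b : R) : projJ (a + b) = projJ a + projJ b.
Proof. exact: raddfD. Qed.

Lemma projJB (a b : R) : projJ (a - b) = projJ a - projJ b.
Proof. exact: raddfB. Qed.

Lemma projJM (a b : R) : projJ (a * b) = projJ a * projJ b.
Proof. exact: (rmorphM (@projJ R)). Qed.

(** A projective cover [P] of [R / I] is a quotient of [R], because the map [g]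
    that lifts the projection is onto modulo a superfluous kernel. Being
    projective, [P] is then a summand [e R] of [R]; and the kernel of
    [P -> R / I] is inside [Rad P], that is, in [J] as seen from [R]. *)
Lemma perfect_cut : right_perfect R -> ideals_cut_by_idempotents.
Proof.
move=> perfR I JI; have [P [p pcov]] := perfR (qmod I).
have [projP p_surj supK] := pcov.
have [w pw] := p_surj (qproj I (1 : rreg R)).
pose g := linear_of (ract_linear w).
have pg r : p (g r) = qproj I r.
  by rewrite linearZ pw -linearZ; congr (qproj I _); exact: (@mul1r R r).
have g_surj : surjective g.
  apply: surjective_mod_superfluous supK _ => x; exists (repr (p x)).
  by rewrite unfold_in linearB pg qproj_surj subrr.
have [s sK] := projP _ _ g idfun g_surj.
pose e : R := s w.
have ge : g e = w by exact: sK.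
exists e => [|r].
  by rewrite -[e * e]/(s w ◃ e) -linearZ -[w ◃ e]/(g e) ge.
have sg : s (g r) = e * r by rewrite linearZ.
apply/idP/idP => [rI|/JI].
  rewrite -[e * r]sg; apply: linear_Rad; apply: (cover_kernel_Rad pcov).
  by rewrite pg; apply/qproj_eq0.
move=> /qproj_eq0; rewrite -pg -sg sK pg.
by move/qproj_eq0.
Qed.

(** In the semisimple ring [R / J], the image of [I] has a complement [L]. With
    [1 = y + z] along this decomposition, [z] is idempotent and annihilates
    exactly the image of [I]; lift [z]. *)
Lemma semiperfect_cut : semiperfect R -> ideals_cut_by_idempotents.
Proof.
move=> [semiR liftR] I JI.
(* The image of [I] in [R / J]; the representatives chosen by [repr] do not
   matter because [J] is inside [I]. *)
pose N (u : rreg (quotJ R)) := (repr u : rreg R) \in I.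
have NE (r : R) : N (projJ r) = (r \in I).
  have d : (repr (projJ r) : rreg R) - r \in I.
    apply: JI; apply/projJ_eq0; rewrite projJB.
    by rewrite [projJ _]qring_proj_surj subrr.
  rewrite /N -(subrK (r : rreg R) (repr (projJ r))).
  exact: (@rpredDl (rreg R) (zmod_of_submod I)).
have NE' (r : R) : ((projJ r : rreg (quotJ R)) \in N) = (r \in I) := NE r.
have cN : submod_closed N.
  split=> [|a u v].
    have -> : (0 : rreg (quotJ R)) = projJ 0 by rewrite raddf0.
    by rewrite NE'; exact: rpred0.
  rewrite -[u](@qring_proj_surj _ _ (@Jacobson_left R)).
  rewrite -[v](@qring_proj_surj _ _ (@Jacobson_left R)).
  rewrite -[a](@qring_proj_surj _ _ (@Jacobson_left R)).
  move: (repr a) (repr u) (repr v) => {}a {}u {}v.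
  rewrite -![qring_proj _ _]/(projJ _).
  rewrite !NE' => uI vI.
  have : (projJ ((u : R) * (a : R) + (v : R)) : rreg (quotJ R)) \in N.
    by rewrite NE'; exact: (submodClosedP I).2.
  by rewrite projJD projJM.
have [L [NL NL0]] := semiR (submod_of cN).
have [y yN [z zL yz1]] := NL (1 : quotJ R).
have uE (u : quotJ R) : u = (y : quotJ R) * u + (z : quotJ R) * u.
  have {}yz1 : (y : quotJ R) + (z : quotJ R) = 1 by [].
  by rewrite -mulrDl yz1 mul1r.
have NZ (u v : quotJ R) : N u -> N (u * v).
  by move=> uN; exact: (@rpredZ _ (rreg (quotJ R)) (submod_of cN) v u uN).
have LZ (u v : quotJ R) : (u : rreg (quotJ R)) \in L ->
    (u * v : rreg (quotJ R)) \in L.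
  by move=> uL; exact: (@rpredZ _ (rreg (quotJ R)) L v u uL).
have zN (u : quotJ R) : N u -> (z : quotJ R) * u = 0.
  move=> uN; apply: NL0; last exact: LZ.
  have -> : (z : quotJ R) * u = u - (y : quotJ R) * u.
    by rewrite {2}(uE u) addrC addKr.
  apply: (@submodB _ _ (submod_of cN)) => //; exact: NZ.
have zz : (z : quotJ R) * z = z.
  apply/eqP; rewrite eq_sym -subr_eq0; apply/eqP; apply: NL0.
    have -> : (z : quotJ R) - z * z = (y : quotJ R) * z.
      by rewrite {1}(uE z) addrK.
    exact: NZ.
  by apply: submodB => //; exact: LZ.
have [e ee ez] := liftR z zz.
exists e => // r; rewrite -NE; apply/idP/idP => [/zN|/projJ_eq0].
  by rewrite -ez -projJM => /projJ_eq0.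
rewrite projJM [X in X * _]ez => zr.
have -> : projJ r = (y : quotJ R) * projJ r.
  by rewrite [LHS]uE zr addr0.
exact: NZ.
Qed.

(** The image of [e R] is a complement of the given right ideal [N]. *)
Lemma cut_semilocal : ideals_cut_by_idempotents -> semilocal R.
Proof.
move=> cut N.
pose T (r : rreg R) := (projJ (r : R) : rreg (quotJ R)) \in N.
have TE (r : R) : (r \in T) = ((projJ r : rreg (quotJ R)) \in N) by [].
have cT : submod_closed T.
  split=> [|a r s]; first by rewrite TE raddf0 rpred0.
  rewrite !TE => rN sN; rewrite -[a *: r + s]/((r : R) * (a : R) + s).
  rewrite projJD projJM.
  exact: (submodClosedP N).2 (projJ (a : R)) _ _ rN sN.
have [|e ee eT] := cut (submod_of cT).
  by move=> r /projJ_eq0 r0; rewrite -[_ \in _]/(r \in T) TE r0 rpred0.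
pose L (v : rreg (quotJ R)) := `[< exists r : R, v = projJ (e * r) >].
have surJ (v : quotJ R) : projJ (repr v : R) = v by exact: qring_proj_surj.
have cL : submod_closed L.
  split=> [|a _ _ /asboolP[r ->] /asboolP[s ->]]; apply/asboolP.
    by exists 0; rewrite mulr0 raddf0.
  exists (r * repr (a : quotJ R) + s).
  by rewrite mulrDr projJD mulrA (projJM (e * r)) surJ.
exists (submod_of cL); split=> [v|v vN /asboolP[r vE]].
  rewrite -[v]surJ; move: (repr (v : quotJ R)) => r.
  exists (projJ ((1 - e) * r)).
    rewrite -TE -[_ \in _]/(_ \in submod_of cT) eT.
    by rewrite mulrA mulrBr mulr1 ee subrr mul0r; exact: rpred0.
  exists (projJ (e * r)); first by apply/asboolP; exists r.
  by rewrite -projJD -mulrDl subrK mul1r.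
rewrite vE -TE -[_ \in _]/(_ \in submod_of cT) eT mulrA ee in vN.
by rewrite vE; apply/projJ_eq0.
Qed.

End Perfect.

(** * Lifting idempotents modulo a nil radical *)

Section Lifting.
Variable R : pzRingType.
Local Notation J := (Rad (rreg R)).

Section Shift.
Local Notation F := (dsum (fun _ : nat => 1 : R)).
Variables (a : R).

Definition prev (x : F) (n : nat) : R := if n is m.+1 then coef x m else 0.

Lemma shift_closed (x : F) :
  dsum_pred (fun _ => 1) ((fun n => a * prev x n) : nat -> rreg R).
Proof.
apply/asboolP; split=> [|n]; last by rewrite mul1r.
exists (map S (supp x)) => -[|n]; first by rewrite mulr0 eqxx.
rewrite mem_map; last exact: succn_inj.
by apply: contraR => /mem_supp /= ->; rewrite mulr0.
Qed.
(** The endomorphism that sends the basis vector [b_n] to [b_(n+1) a]. *)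
Definition shift x : F :=
  exist (fun f => is_true (dsum_pred _ f)) _ (shift_closed x).

(** In the free module with basis [b_0, b_1, ...], the elements
    [b_n - b_(n+1) a] generate everything modulo the radical, hence everything
    if the radical is superfluous. Solving [b_0 = g - shift g] forces the
    coordinates of [g] to be the powers of [a], and [g] has finite support. *)
Lemma Jacobson_nil : superfluous (Rad F) -> a \in J -> exists n, a ^+ n = 0.
Proof.
move=> supF aJ.
have ee (n : nat) : 1 * 1 = 1 :> R by rewrite mulr1.
pose T (x : F) := `[< exists g : F, x = g - shift g >].
have shiftE r (g h : F) : shift (r *: g + h) = r *: shift g + shift h.
  apply/val_inj/funext => -[|n].
    by rewrite -[RHS]/(a * 0 * (r : R) + a * 0 : R) mulr0 mul0r addr0 /= mulr0.
  rewrite -[RHS]/(a * (coef g n : R) * (r : R) + a * (coef h n : R)).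
  by rewrite -mulrA -mulrDr.
have cT : submod_closed T.
  split=> [|r _ _ /asboolP[g ->] /asboolP[h ->]]; apply/asboolP.
    have := shiftE (-1) 0 0; rewrite scaler0 addr0 scaleN1r addNr => shift0.
    by exists 0; rewrite shift0 subrr.
  by exists (r *: g + h); rewrite shiftE scalerBr opprD addrACA.
have [prT|fullT] := pselect (proper_submod (submod_of cT)).
  exfalso; apply: (supF _ prT) => x.
  exists (shift x).
    by apply: (dsum_Rad ee) => n; exact: Jacobson_right.
  exists (x - shift x); first by apply/asboolP; exists x.
  by rewrite addrC subrK.
have /asboolP[g g0] : single ee 0 \in submod_of cT.
  by apply: contrapT => /negP s0; apply: fullT; exists (single ee 0).
have gE n : (coef g n : R) = coef (single ee 0) n + a * prev g n.
  by rewrite g0; apply/esym; exact: subrK.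
have gn n : coef g n = a ^+ n.
  elim: n => [|n IHn]; rewrite gE /=.
    by rewrite /coef /= /single_fun eqxx mulr0 addr0.
  by rewrite IHn exprS /coef /= /single_fun add0r.
exists (\max_(i <- supp g) i).+1; rewrite -gn; apply: mem_supp.
apply/negP => gN; have := @leq_bigmax_seq _ (supp g) xpredT id _ gN isT.
by rewrite ltnn.
Qed.

End Shift.

(** The terms of [(x + y)^3 = 1] with at least two factors [x], and those with
    at least two factors [y]. *)
Lemma cubic_split (x y : R) : GRing.comm x y -> x + y = 1 ->
  1 - x * x * (x + y *+ 3) = y * y * (y + x *+ 3).
Proof.
move=> xy xy1; have := exprDn_comm 3 xy; rewrite xy1 expr1n => {1}->.
rewrite !big_ord_recr big_ord0 /= add0r.
rewrite -['C(3, 0)]/1%N -['C(3, 1)]/3%N -['C(3, 2)]/3%N -['C(3, 3)]/1%N.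
rewrite -[(3 - 0)%N]/3%N -[(3 - 1)%N]/2%N -[(3 - 2)%N]/1%N.
rewrite !exprSr !expr0 !mulr1 !mul1r.
have yyx : y * y * x = x * (y * y) by rewrite -mulrA -xy mulrA -xy mulrA.
rewrite [x * x * (_ + _)]mulrDr [y * y * (_ + _)]mulrDr !mulrnAr yyx !mulr1n.
by rewrite [LHS]addrAC [X in X + _]addrAC subrr add0r addrC.
Qed.

(** The iteration [x -> 3 x^2 - 2 x^3], here written [x^2 (x + 3 y)] with
    [y = 1 - x], does not change [x] modulo [J] when [x y] is in [J], and it
    replaces the defect [x y] by a multiple of its square. *)
Lemma nil_idempotent (x : R) k : x * (1 - x) \in J ->
  (x * (1 - x)) ^+ (2 ^ k) = 0 -> exists2 e : R, e * e = e & projJ e = projJ x.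
Proof.
elim: k x => [|k IHk] x.
  rewrite expn0 expr1 => _ /eqP; rewrite mulrBr mulr1 subr_eq0 => /eqP xx.
  by exists x.
have : x + (1 - x) = 1 by rewrite addrC subrK.
have : GRing.comm x (1 - x) by apply: commrB; [exact: commr1 | ].
move: (1 - x) => y xy xy1 xyJ nil.
pose e := x * x * (x + y *+ 3).
have eC : 1 - e = y * y * (y + x *+ 3) by exact: cubic_split.
have Cx (z : R) : GRing.comm x z -> GRing.comm y z -> GRing.comm (x * y) z.
  by move=> xz yz; apply/commr_sym; apply: commrM; apply/commr_sym.
have xu : GRing.comm x (x + y *+ 3) by apply: commrD => //; apply: commrMn.
have yu : GRing.comm y (x + y *+ 3).
  by apply: commrD => //; apply: commrMn.
have yv : GRing.comm y (y + x *+ 3).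
  by apply: commrD => //; apply: commrMn; apply: commr_sym.
have xv : GRing.comm x (y + x *+ 3) by apply: commrD => //; apply: commrMn.
pose c := (x + y *+ 3) * (y + x *+ 3).
have eeC : e * (1 - e) = x * y * (x * y) * c.
  rewrite eC /e /c -!mulrA; congr (x * _); rewrite !mulrA.
  rewrite -[x * (x + y *+ 3) * y]mulrA -yu mulrA xy.
  rewrite -!mulrA; congr (y * _); rewrite !mulrA.
  by rewrite -[x * (x + y *+ 3) * y]mulrA -yu mulrA.
have [f ff fe] : exists2 f : R, f * f = f & projJ f = projJ e.
  apply: IHk; rewrite eeC; first by do 2 apply: Jacobson_right.
  have xyc : GRing.comm (x * y) c by apply: commrM; apply: Cx.
  rewrite exprMn_comm; last first.
    by apply: commr_sym; apply: commrM; apply: commr_sym.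
  by rewrite -expr2 -exprM -expnS nil mul0r.
exists f => //; rewrite fe.
apply/eqP; rewrite -subr_eq0 -projJB; apply/eqP/projJ_eq0.
have xE : x * x * x = x - x * y - x * y * x.
  have xyE : x * y = x - x * x.
    by apply/eqP; rewrite eq_sym subr_eq addrC -mulrDr xy1 mulr1.
  by rewrite xyE mulrBl !subKr.
have -> : e - x = x * y * (x *+ 3 - 1 - x).
  have xxy : x * x * y = x * y * x by rewrite -!mulrA xy.
  rewrite /e mulrDr mulrnAr xE xxy !mulrBr mulr1 mulrnAr.
  rewrite [LHS]addrAC [X in X + _]addrAC [X in X + _ + _]addrAC.
  by rewrite subrr add0r addrC addrA.
exact: Jacobson_right.
Qed.

Lemma Jacobson_nil_lift : (forall a : R, a \in J -> exists n, a ^+ n = 0) ->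
  idempotents_lift_mod_J R.
Proof.
move=> nilJ u uu; pose a : R := repr u.
have au : projJ a = u by exact: qring_proj_surj.
have aJ : a * (1 - a) \in J.
  by apply/projJ_eq0; rewrite mulrBr mulr1 projJB projJM au uu subrr.
have [n an] := nilJ _ aJ; rewrite -au.
apply: (@nil_idempotent a n) => //.
by rewrite -(subnK (ltnW (ltn_expl n (ltnSn 1)))) exprD an mulr0.
Qed.

End Lifting.

(** * Covers by sums of local projective modules *)

Section Core.
Variable R : pzRingType.
Local Notation J := (Rad (rreg R)).
Local Notation "x ◃ r" := ((r : R^c) *: x).

(** When [e] is idempotent, [r |-> e r] identifies the quotient of [R] by this
    ideal with [e R / e J]. *)
Definition colonJ (e : R) : {pred rreg R} := fun r => e * (r : R) \in J.

Lemma colonJ_closed e : submod_closed (colonJ e).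
Proof.
have E (r : rreg R) : (r \in colonJ e) = (e * (r : R) \in J) by [].
split=> [|b r s]; rewrite !E; first by rewrite mulr0; exact: rpred0.
by move=> rJ sJ; rewrite mulrDr mulrA; exact: (submodClosedP (Rad (rreg R))).2.
Qed.

(** Then [e R / e J] is simple, so that [e R] is a local projective module. *)
Definition local_idempotent (e : R) :=
  e * e = e /\ maximal_submod (submod_of (colonJ_closed e)).

Lemma maximal_cut (I : submodClosed (rreg R)) :
  ideals_cut_by_idempotents R -> maximal_submod I ->
  exists2 e, local_idempotent e & forall r : R, (r \in I) = (e * r \in J).
Proof.
move=> cut maxI; have [|e ee eI] := cut I.
  by move=> r /asboolP; apply.
exists e => //; split=> //.
have EI : submod_of (colonJ_closed e) =i I by move=> r; rewrite eI.
case: maxI => -[x xI] maxI; split=> [|L EL prL r].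
  by exists x; rewrite EI.
by rewrite EI; apply: maxI => // s; rewrite -EI; exact: EL.
Qed.

Section Independent.
Variable M : rmodType R.
Implicit Types (T : set (M * R)) (s : seq (M * R)).

(** A pair [(m, e)] with [m = m e] stands for the map [e R -> M] that sends
    [e r] to [m r]. Independence says that the induced map from the direct sum
    of the [e R] into [M / Rad M] kills nothing outside the elements with
    coordinates in [J]. *)
Definition independent T :=
  (forall t, T t -> local_idempotent t.2 /\ t.1 ◃ t.2 = t.1) /\
  forall s (r : M * R -> R), uniq s -> (forall t, t \in s -> T t) ->
    (forall t, t.2 * r t = r t) -> \sum_(t <- s) t.1 ◃ r t \in Rad M ->
    forall t, t \in s -> r t \in J.

(** Independence only involves finite lists, and a finite list in the union of
    a chain lies in one of its members. *)
Lemma maximal_independent :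
  exists T, independent T /\ forall T', (T `<` T')%classic -> ~ independent T'.
Proof.
apply: Zorn_bigcup => F FI totF; split=> [t [X FX Xt]|s r us sF rt sumR].
  exact: (FI X FX).1.
have [X [s0|[FX sX]]] : exists X, s = [::] \/ F X /\ forall t, t \in s -> X t.
  elim: s sF {us sumR} => [|t s IHs] sF; first by exists set0; left.
  have [X FX Xt] : (\bigcup_(X in F) X)%classic t by apply: sF; exact: mem_head.
  have [|Y [->|[FY sY]]] := IHs.
  - by move=> u us; apply: sF; rewrite inE us orbT.
  - by exists X; right; split=> // u; rewrite inE => /eqP->.
  - case: (totF _ _ FX FY) => XY.
      exists Y; right; split=> // u.
      by rewrite inE => /orP[/eqP->|]; [exact: XY | exact: sY].
    exists X; right; split=> // u.
    by rewrite inE => /orP[/eqP-> //|/sY]; exact: XY.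
- by rewrite s0.
- exact: (FI X FX).2.
Qed.

Definition index_idem T (t : M * R) : R := if `[< T t >] then t.2 else 0.

Lemma index_idemT T t : T t -> index_idem T t = t.2.
Proof. by rewrite /index_idem => /asboolT->. Qed.

Definition index_sum T : {linear dsum (index_idem T) -> M} :=
  dsum_lift (fun t => t.1).

Section Maximal.
Variable T : set (M * R).
Hypothesis indT : independent T.

Lemma index_idem_idem t : index_idem T t * index_idem T t = index_idem T t.
Proof.
by rewrite /index_idem; case: asboolP => [/indT.1[[]]//|_]; rewrite mulr0.
Qed.

Lemma index_sum_Rad (f : dsum (index_idem T)) :
  index_sum T f \in Rad M -> forall t, coef f t \in J.
Proof.
pose s := [seq t <- supp f | `[< T t >]].
have sf t : t \notin s -> coef f t = 0.
  rewrite mem_filter negb_and => /orP[nT|/mem_supp//].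
  by rewrite -dsum_idem /index_idem (negPf nT) mul0r.
have us : uniq s by rewrite filter_uniq ?supp_uniq.
have sT t : t \in s -> T t by rewrite mem_filter => /andP[/asboolP].
rewrite /= (dsum_sumE _ us sf) => sumR t.
have [ts|/sf->] := boolP (t \in s); last exact: rpred0.
apply: (indT.2 s (coef f) us sT _ sumR) => // u.
have [us'|/sf->] := boolP (u \in s); last by rewrite mulr0.
by rewrite -[in RHS]dsum_idem index_idemT //; exact: sT.
Qed.

Lemma index_sum_single t : T t -> index_sum T (single index_idem_idem t) = t.1.
Proof.
move=> Tt; rewrite /= (@dsum_sumE _ _ _ _ _ [:: t]) //.
  rewrite big_seq1 /coef /= /single_fun eqxx index_idemT //.
  exact: (indT.1 _ Tt).2.
by move=> u; rewrite inE /coef /= /single_fun => /negPf ->.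
Qed.

Hypothesis maxT : forall T', (T `<` T')%classic -> ~ independent T'.
Hypothesis cut : ideals_cut_by_idempotents R.

(** Otherwise let [N] be the proper submodule generated by [Rad M] and the
    images of the [e R], and [x] outside [N]. The right ideal of those [r] with
    [x r] in [N] is proper and contains [J]; cut a maximal ideal [I'] above it
    by a local idempotent [e]. The pair [(x e, e)] can be added to [T]: in a
    relation modulo [Rad M], its coefficient [r = e r] satisfies [x r] in [N],
    so [r] is in [I'], that is, [r] is in [J]; then its term is in [Rad M], and
    the other coefficients are in [J] by independence of [T]. *)
Lemma index_sum_mod_Rad x : exists f, x - index_sum T f \in Rad M.
Proof.
apply: contrapT => xT.
pose M' (y : M) := `[< exists f, y - index_sum T f \in Rad M >].
have cM' : submod_closed M'.
  split=> [|a y z /asboolP[f yf] /asboolP[g zg]]; apply/asboolP.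
    by exists 0; rewrite raddf0 subr0 rpred0.
  exists (a *: f + g); rewrite linearP opprD addrACA -scalerBr.
  exact: (submodClosedP (Rad M)).2.
pose N := submod_of cM'.
have RadN y : y \in Rad M -> y \in N.
  by move=> yR; apply/asboolP; exists 0; rewrite raddf0 subr0.
have TN t : T t -> t.1 \in N.
  move=> /index_sum_single E; apply/asboolP; exists (single index_idem_idem t).
  by rewrite E subrr rpred0.
pose I := submod_of (preim_submod_closed (linear_of (ract_linear x)) N).
have IE (r : R) : (r \in I) = (x ◃ r \in N) by [].
have I1 : (1 : (R^c)^o) \notin I.
  by apply/negP; rewrite IE scale1r => /asboolP.
have [I' maxI' II'] := maximal_submod_above I1.
have [e [ee maxe] eI'] := maximal_cut cut maxI'.
have xeN : x ◃ e \notin N.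
  rewrite -IE; apply/negP => /II'.
  rewrite eI' ee => /(idempotent_Jacobson ee) e0.
  have [[z /negP zI] _] := maxI'; apply: zI.
  by rewrite eI' e0 mul0r; exact: rpred0.
pose t0 : M * R := (x ◃ e, e).
have T0 : ~ T t0 by move=> /TN; apply/negP.
apply: (maxT (T' := (T `|` [set t0])%classic)).
  rewrite properEneq; split=> [|t]; last by left.
  by apply/eqP => TE; apply: T0; rewrite TE; right.
split=> [t [/indT.1//|->]|s r us sT rt].
  by split=> //; rewrite ractA ee.
have mem_T t : t \in s -> t != t0 -> T t by move=> /sT[//|->]; rewrite eqxx.
have [t0s|t0s] := boolP (t0 \in s); last first.
  apply: indT.2 => // t ts; apply: mem_T => //.
  by apply: contraNneq t0s => <-.
rewrite (bigD1_seq t0) //= -big_filter; set s' := filter _ _ => sumR.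
have s'T t : t \in s' -> T t by rewrite mem_filter => /andP[/[swap]/mem_T].
have us' : uniq s' by rewrite filter_uniq.
have s'N : \sum_(t <- s') t.1 ◃ r t \in N.
  by rewrite big_seq; apply: rpred_sum => t /s'T/TN tN; exact: rpredZ.
have rJ : r t0 \in J.
  rewrite -(rt t0) /= -eI'; apply: II'; rewrite IE.
  have := submodB (RadN _ sumR) s'N; rewrite addrK ractA.
  by rewrite (rt t0).
have s'R : \sum_(t <- s') t.1 ◃ r t \in Rad M.
  by have := submodB sumR (ract_Rad t0.1 rJ); rewrite addrAC subrr add0r.
move=> t ts; have [->//|tt0] := eqVneq t t0.
by apply: (indT.2 s') => //; rewrite mem_filter tt0.
Qed.
End Maximal.
End Independent.

(** When the radical of the direct sum is superfluous, this is a projective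
    cover of [M]. *)
Definition local_cover (M : rmodType R) (I : choiceType) (e : I -> R)
    (p : {linear dsum e -> M}) :=
  [/\ forall i, e i = 0 \/ local_idempotent (e i), surjective p &
      forall f, p f = 0 -> forall i, coef f i \in J].

Lemma local_cover_idem M I e p :
  @local_cover M I e p -> forall i, e i * e i = e i.
Proof.
by case=> eP _ _ i; case: (eP i) => [->|[]//]; rewrite mulr0.
Qed.

Lemma local_cover_exists (M : rmodType R) :
  ideals_cut_by_idempotents R -> superfluous (Rad M) ->
  exists (e : M * R -> R) (p : {linear dsum e -> M}), local_cover p.
Proof.
move=> cut supM; have [T [indT maxT]] := maximal_independent M.
exists (index_idem T), (index_sum T); split=> [t|x|f pf0]; last first.
- by apply: index_sum_Rad => //; rewrite pf0 rpred0.
- exact: (surjective_mod_superfluous supM (index_sum_mod_Rad indT maxT cut)).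
rewrite /index_idem; case: asboolP => [/indT.1[]|_]; by [right|left].
Qed.

(** * Max-projective modules *)

(** The [j]-th coordinate modulo the radical is well defined on [M], because
    the kernel of [p] has coordinates in [J]. It is a map from [M] to a simple
    module [R / I], so it lifts to [R] when [M] is max-projective. *)
Lemma local_cover_coordinate (M : rmodType R) (I : choiceType) (e : I -> R)
    (p : {linear dsum e -> M}) : local_cover p -> max_projective M ->
  forall j, exists g : {linear M -> rreg R},
    forall f, coef f j - e j * (g (p f) : R) \in J.
Proof.
move=> [eP p_surj kerJ] maxM j; have [ej0|[ee maxe]] := eP j.
  exists (\0 : {linear M -> rreg R}) => f.
  by rewrite -dsum_idem ej0 !mul0r subrr; exact: rpred0.
set E := submod_of (colonJ_closed (e j)) in maxe.
have EE (f : dsum e) : p f = 0 -> coef f j \in E.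
  by move=> /kerJ/(_ j) fJ; exact: Jacobson_left.
have Ep f g : p f = p g -> qproj E (coef f j) = qproj E (coef g j).
  move=> fg; apply/qproj_eq; rewrite -[_ - _]/(coef (f - g) j); apply: EE.
  by rewrite linearB fg subrr.
pose pre x := sval (cid (p_surj x)).
have preK x : p (pre x) = x by rewrite /pre; case: cid.
pose q x := qproj E (coef (pre x) j).
have qp f : q (p f) = qproj E (coef f j) by apply: Ep; rewrite preK.
have q_lin : linear q.
  move=> a x y; rewrite -[in LHS](preK x) -[in LHS](preK y) -linearP.
  by rewrite qp dsum_coefD linearP.
have [g gP] := maxM E maxe (linear_of q_lin).
exists g => f; have /qproj_eq : qproj E (coef f j) = qproj E (g (p f)).
  by rewrite -gP -qp.
rewrite -[_ \in _]/(e j * ((coef f j : R) - (g (p f) : R)) \in J).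
by rewrite mulrBr dsum_idem.
Qed.

(** Multiplied by [e j], the lifts [g j] of the coordinate functions invert [p]
    modulo [J]. Applied to [p f = 0], they express each coordinate of [f] as a
    combination of its coordinates with coefficients in [J]. *)
Lemma local_cover_injective (M : rmodType R) (I : choiceType) (e : I -> R)
    (p : {linear dsum e -> M}) : local_cover p -> max_projective M ->
  forall f, p f = 0 -> f = 0.
Proof.
move=> covp maxM f pf0; have ee := local_cover_idem covp.
pose g j := sval (cid (local_cover_coordinate covp maxM j)).
have gJ j x : coef x j - e j * (g j (p x) : R) \in J by rewrite /g; case: cid.
pose c j i : R := coef (single ee i) j - e j * (g j (p (single ee i)) : R).
have cJ j i : c j i \in J by exact: gJ.
have f0 : forall i, i \in supp f -> (coef f i : R) = 0.
  apply: (Nakayama_system cJ) => j _.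
  have fE : (coef f j : R) =
      \sum_(i <- supp f) (coef (single ee i) j : R) * (coef f i : R).
    rewrite [in LHS](dsumE ee f) -[LHS]/(dsum_proj _ j _) linear_sum.
    by apply: eq_bigr => i _; rewrite linearZ.
  have gE : \sum_(i <- supp f)
      e j * (g j (p (single ee i)) : R) * (coef f i : R) = 0.
    under eq_bigr do rewrite -mulrA.
    rewrite -big_distrr /= -[RHS](mulr0 (e j)); congr (_ * _).
    transitivity (g j (p f) : R); last by rewrite pf0 raddf0.
    rewrite [in RHS](dsumE ee f) !linear_sum.
    by apply: eq_bigr => i _; rewrite !linearZ.
  rewrite -[LHS]subr0 -[X in _ - X = _]gE [in LHS]fE -sumrB.
  by apply: eq_bigr => i _; rewrite mulrBl.
apply/val_inj/funext => i; rewrite -[LHS]/(coef f i).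
by have [/f0|/mem_supp] := boolP (i \in supp f).
Qed.

Lemma max_projective_small_Rad (M : rmodType R) :
  ideals_cut_by_idempotents R -> max_projective M -> superfluous (Rad M) ->
  projective M.
Proof.
move=> cut maxM supM; have [e [p covp]] := local_cover_exists cut supM.
have ee := local_cover_idem covp; have [_ p_surj _] := covp.
apply: projective_iso (dsum_projective ee) p_surj _.
exact: local_cover_injective.
Qed.

Lemma perfect_of_small_Rad : ideals_cut_by_idempotents R ->
  (forall M : rmodType R, superfluous (Rad M)) -> right_perfect R.
Proof.
move=> cut supR M; have [e [p covp]] := local_cover_exists cut (supR M).
have ee := local_cover_idem covp; have [_ p_surj kerJ] := covp.
exists (dsum e), p; split=> //; first exact: dsum_projective.
apply: superfluousS (supR _) => f /eqP/kerJ; exact: dsum_Rad.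
Qed.

(** A module without maximal submodules has only zero maps to simple
    modules. *)
Lemma Rad_full_max_projective (X : rmodType R) :
  (forall x : X, x \in Rad X) -> max_projective X.
Proof.
move=> RadX I maxI f; exists (\0 : {linear X -> rreg R}) => x.
by rewrite raddf0; apply: Rad_simple_quotient maxI _; exact: linear_Rad.
Qed.

End Core.

Theorem proposition8 (R : pzRingType) :
  (semiperfect R ->
     forall M : rmodType R,
       max_projective M -> superfluous (Rad M) -> projective M) /\
  (right_perfect R <->
     semilocal R /\ (forall M : rmodType R, max_projective M -> projective M)).
Proof.
split=> [semiR M maxM|].
  exact: max_projective_small_Rad (semiperfect_cut semiR) maxM.
split=> [perfR|[semiR maxR]].
  have cut := perfect_cut perfR.
  split=> [|M maxM]; first exact: cut_semilocal.
  apply: max_projective_small_Rad => //.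
  exact/Rad_superfluous/perfect_Rad_eq0.
have supR (M : rmodType R) : superfluous (Rad M).
  apply: Rad_superfluous => X RadX; apply: projective_Rad_eq0 => //.
  exact/maxR/Rad_full_max_projective.
apply: perfect_of_small_Rad => //; apply: semiperfect_cut; split=> //.
by apply: Jacobson_nil_lift => a; exact: Jacobson_nil.
Qed.
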